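(* (i) If $G$ is an edge $k$-colourable graph and $\lambda=\{k_1,\dots,k_q\}$ is a partition of $k$ with $k_i\le 2$ for all $i$, then $G$ is edge $\lambda$-choosable. (ii) If $n$ is an even positive integer and $\lambda=\{k_1,\dots,k_q\}$ is a partition of $n-1$ with $k_i\le 3$ for all $i$, then the complete graph $K_n$ is edge $\lambda$-choosable.
   Context: A partition of $k$ is a multiset of positive integers summing to $k$. For a partition $\lambda=\{k_1,\dots,k_q\}$ of $k$, a $\lambda$-assignment of a graph $H$ is an assignment $L$ of colour sets with $|L(v)|=k$ for all $v$ such that $\bigcup_vL(v)$ can be partitioned into sets $C_1,\dots,C_q$ with $|L(v)\cap C_i|=k_i$ for all $v$ and $i$; $H$ is $\lambda$-choosable if for every $\lambda$-assignment $L$ there is a proper colouring $f$ with $f(v)\in L(v)$ for all $v$. A graph $G$ is edge $k$-colourable (resp. edge $\lambda$-choosable) if its line graph is $k$-colourable (resp. $\lambda$-choosable). *)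

(* Defs.v *)
From mathcomp Require Import all_boot.
Set Implicit Arguments. Unset Strict Implicit. Unset Printing Implicit Defensive.

Definition is_partition (k : nat) (lam : seq nat) : Prop :=
  all (fun x => 0 < x) lam /\ sumn lam = k.

Definition proper_L_colouring (T : finType) (adj : rel T) (L : T -> seq nat)
  (f : T -> nat) : Prop :=
  (forall v, f v \in L v) /\ (forall u v, adj u v -> f u != f v).

Definition colourable (T : finType) (adj : rel T) (k : nat) : Prop :=
  exists f : T -> 'I_k, forall u v, adj u v -> f u != f v.

(* L is a lambda-assignment: each L v is a set (duplicate-free list) of k colours,
   and there is a partition of the colours into classes C_0,...,C_{q-1}
   (class of colour c is part c) with |L v ∩ C_i| = k_i for all v, i. *)
Definition lambda_assignment (T : finType) (lam : seq nat) (L : T -> seq nat) : Prop :=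
  (forall v, uniq (L v) /\ size (L v) = sumn lam) /\
  exists part : nat -> nat,
    forall v i, i < size lam -> count (fun c => part c == i) (L v) = nth 0 lam i.

Definition lambda_choosable (T : finType) (adj : rel T) (lam : seq nat) : Prop :=
  forall L : T -> seq nat, lambda_assignment lam L ->
    exists f : T -> nat, proper_L_colouring adj L f.

(* Simple graphs: symmetric irreflexive relation e on a finite vertex type V.
   Edges are 2-element vertex sets {x,y} with e x y. *)
Definition is_edge (V : finType) (e : rel V) (s : {set V}) : bool :=
  [exists x, exists y, e x y && (s == [set x; y])].

Definition edge_type (V : finType) (e : rel V) := {s : {set V} | is_edge e s}.

Definition line_adj (V : finType) (e : rel V) : rel (edge_type e) :=
  fun s t => (s != t) && (val s :&: val t != set0).

Definition edge_colourable (V : finType) (e : rel V) (k : nat) : Prop :=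
  colourable (@line_adj V e) k.

Definition edge_lambda_choosable (V : finType) (e : rel V) (lam : seq nat) : Prop :=
  lambda_choosable (@line_adj V e) lam.

Definition complete_rel (n : nat) : rel 'I_n := fun x y => x != y.

(* Main.v *)
(* Colour classes with different indices have disjoint lists, so it suffices to split
   the edge set into unions of [d + 1] matchings ([d <= 2]), one for each part [d + 1],
   that are each [(d + 1)]-choosable.  By the Alon-Tarsi method, a [(d + 1)]-regular
   union of perfect matchings is choosable as soon as one coefficient of its graph
   polynomial is nonzero.  That coefficient is computed with the lists
   [{0, ..., d}], where it is a signed count of the proper colourings.  All signs agree
   when [d <= 1], and also when the proper colouring is unique up to a permutation of
   the colours.  In the round-robin 1-factorization of [K_n], any three consecutive
   matchings form a ladder closed at both ends, whose 3-edge-colouring is unique in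
   this sense. *)
Require Import Defs.
From mathcomp Require Import all_boot.
From mathcomp Require Import all_order all_algebra zify.

Set Implicit Arguments.
Unset Strict Implicit.
Unset Printing Implicit Defensive.

Import Order.TTheory GRing.Theory Num.Theory.

Local Open Scope ring_scope.

(** * Lagrange interpolation weights *)

(** The leading coefficient of the Lagrange basis polynomial of the node [x i]. *)
Definition lagrange_weight (F : fieldType) (I : finType) (x : I -> F) (i : I) : F :=
  (\prod_(j | j != i) (x i - x j))^-1.

Lemma lagrange_weight_neq0 (F : fieldType) (I : finType) (x : I -> F) (i : I) :
  injective x -> lagrange_weight x i != 0.
Proof.
move=> x_inj; rewrite invr_eq0; apply/prodf_neq0 => j ji.
by rewrite subr_eq0 (inj_eq x_inj) eq_sym.
Qed.

(* Compare the coefficients of degree [d] in the interpolation formula for ['X^t]. *)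
Lemma sum_lagrange_weight (F : fieldType) (d : nat) (x : 'I_d.+1 -> F) (t : nat) :
  injective x -> (t <= d)%N ->
  \sum_i lagrange_weight x i * x i ^+ t = (t == d)%:R.
Proof.
move=> x_inj t_le.
pose l i : {poly F} := \prod_(j | j != i) ('X - (x j)%:P).
have l_eval i k : (l i).[x k] = if k == i then (lagrange_weight x i)^-1 else 0.
  rewrite horner_prod invrK; case: eqP => [->|/eqP ki].
    by apply: eq_bigr => j _; rewrite hornerXsubC.
  by rewrite (bigD1 k) //= hornerXsubC subrr mul0r.
have l_size i : size (l i) = d.+1.
  rewrite /l -big_filter size_prod_XsubC -[size _]sum1_size big_filter.
  rewrite sum1_card; have := cardC1 i; rewrite card_ord /= => e.
  by congr _.+1; rewrite -[RHS]e; apply: eq_card.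
have l_coef i : (l i)`_d = 1.
  have /monicP : l i \is monic by apply: monic_prod_XsubC.
  by rewrite lead_coefE l_size.
(* The interpolation error of ['X^t]: its size is at most [d.+1], yet it has [d.+1] roots. *)
pose p := 'X^t - \sum_i (lagrange_weight x i * x i ^+ t) *: l i.
have p0 : p = 0.
  apply: (@roots_geq_poly_eq0 _ _ [seq x i | i : 'I_d.+1]).
  - apply/allP => _ /mapP[k _ ->]; rewrite /root hornerD hornerN hornerXn.
    rewrite horner_sum (bigD1 k) //= big1 => [|i ik].
      rewrite hornerZ l_eval eqxx addr0 mulrAC mulfV ?mul1r ?subrr //.
      exact: lagrange_weight_neq0.
    by rewrite hornerZ l_eval eq_sym (negPf ik) mulr0.
  - by rewrite map_inj_uniq ?enum_uniq.
  - rewrite size_map -cardE card_ord (leq_trans (size_polyD _ _)) // geq_max.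
    rewrite size_polyXn ltnS t_le size_polyN.
    apply: (leq_trans (size_sum _ _ _)); apply/bigmax_leqP => i _.
    by rewrite (leq_trans (size_scale_leq _ _)) // l_size.
have := congr1 (fun q : {poly F} => q`_d) p0.
rewrite coef0 coefB coefXn coef_sum eq_sym => /eqP; rewrite subr_eq0 => /eqP ->.
by apply: eq_bigr => i _; rewrite coefZ l_coef mulr1.
Qed.

(** * Orientations and the graph polynomial *)

Definition orientation_sign (R : nzRingType) (J : finType) (o : J -> bool) : R :=
  \prod_j (-1) ^+ o j.

(** The exponent of the variable of [e] in the monomial that takes [q j] where [o j] holds and [p j]
    elsewhere. *)
Definition indegree (E J : finType) (p q : J -> E) (o : J -> bool) (e : E) : nat :=
  #|[pred j | (if o j then q j else p j) == e]|.

Lemma sum_indegree (E J : finType) (p q : J -> E) (o : J -> bool) :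
  (\sum_e indegree p q o e = #|J|)%N.
Proof.
rewrite -sum1_card (partition_big (fun j => if o j then q j else p j) xpredT) //=.
by apply: eq_bigr => e _; rewrite sum1_card; apply: eq_card.
Qed.

(* The right-hand side, a coefficient of the graph polynomial, does not depend on
   the list [x e] of values allowed at [e]. *)
Lemma graph_polynomial_coefficient (R : comNzRingType) (E J : finType) (p q : J -> E)
    (d : nat) (x w : E -> 'I_d.+1 -> R) :
  #|J| = (d * #|E|)%N ->
  (forall e t, (t <= d)%N -> \sum_i w e i * x e i ^+ t = (t == d)%:R) ->
  \sum_(f : {ffun E -> 'I_d.+1}) (\prod_e w e (f e)) *
      \prod_j (x (p j) (f (p j)) - x (q j) (f (q j)))
  = \sum_(o : {ffun J -> bool} | [forall e, indegree p q o e == d])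
      orientation_sign R o.
Proof.
move=> cardJ wx.
pose r (o : J -> bool) j := if o j then q j else p j.
have expand (f : {ffun E -> 'I_d.+1}) :
    \prod_j (x (p j) (f (p j)) - x (q j) (f (q j)))
    = \sum_(o : {ffun J -> bool}) orientation_sign R o *
        \prod_e x e (f e) ^+ indegree p q o e.
  (* Choosing one term in every factor amounts to choosing an orientation. *)
  transitivity (\prod_j \sum_(b : bool) (-1) ^+ b *
      x (if b then q j else p j) (f (if b then q j else p j))).
    by apply: eq_bigr => j _; rewrite big_bool /= mulN1r mul1r addrC.
  rewrite bigA_distr_bigA; apply: eq_bigr => o _; rewrite big_split /=.
  congr (_ * _); rewrite (partition_big (r o) xpredT) //=.
  apply: eq_bigr => e _; rewrite (eq_bigr (fun _ => x e (f e))).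
    by rewrite prodr_const; congr (_ ^+ _); apply: eq_card.
  by move=> j /eqP <-.
under eq_bigr => f _ do rewrite expand mulr_sumr.
rewrite exchange_big /= [RHS]big_mkcond /=; apply: eq_bigr => o _.
transitivity (orientation_sign R o *
    \prod_e \sum_i w e i * x e i ^+ indegree p q o e).
  rewrite bigA_distr_bigA mulr_sumr; apply: eq_bigr => f _.
  by rewrite mulrCA big_split.
case: ifPn => [/forallP deg_o | /forallPn[e0 deg_e0]].
  rewrite big1 ?mulr1 // => e _; rewrite (eqP (deg_o e)) wx //.
  by rewrite eqxx.
(* The indegrees average [d], so if they are not all equal to [d], some one is below [d], and its
   weighted sum vanishes. *)
suff [e lt_e] : exists e, (indegree p q o e < d)%N.
  by rewrite (bigD1 e) //= wx 1?ltnW // (ltn_eqF lt_e) mul0r mulr0.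
apply/existsP; apply: contraNT deg_e0; rewrite negb_exists => /forallP ge_d.
have le_d e : true -> (d <= indegree p q o e ?= iff (d == indegree p q o e))%N.
  by move=> _; split=> //; rewrite leqNgt.
have [_] := leqif_sum le_d.
rewrite sum_indegree cardJ sum_nat_const mulnC eqxx => /esym/forallP/(_ e0).
by rewrite eq_sym.
Qed.

(** * Vandermonde products and unions of perfect matchings *)

(** Together with a vertex, such a pair indexes an adjacency of the line graph; parallel edges are
    adjacent once per common end. *)
Definition color_pair (d : nat) := {ij : 'I_d.+1 * 'I_d.+1 | (ij.1 < ij.2)%N}.

Lemma card_color_pair (d : nat) : (2 * #|{: color_pair d}| = d.+1 * d)%N.
Proof.
rewrite card_sig -sum1_card (partition_big snd xpredT) //=.
rewrite (eq_bigr (fun j : 'I_d.+1 => j : nat)) => [|j _].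
  by rewrite -(big_mkord xpredT id) bin2_sum -mul_bin_diag bin1.
rewrite (reindex_onto (fun i : 'I_d.+1 => (i, j)) fst) => [|[i k] /andP[_ /eqP <-] //].
rewrite -[RHS]card_ord -sum1_card (big_ord_widen d.+1 (fun=> 1%N) (ltnW (ltn_ord j))).
by apply: eq_bigl => i; rewrite /= !eqxx !andbT.
Qed.

(** The Vandermonde product, up to sign. *)
Definition difference_product (d : nat) (x : 'I_d.+1 -> nat) : rat :=
  \prod_(k : color_pair d) ((x (val k).1)%:R - (x (val k).2)%:R).

Lemma difference_product_neq0 (d : nat) (x : 'I_d.+1 -> nat) :
  injective x -> difference_product x != 0.
Proof.
move=> x_inj; apply/prodf_neq0 => -[[i j] /= ij] _.
by rewrite subr_eq0 eqr_nat (inj_eq x_inj); move: ij; rewrite ltn_neqAle => /andP[].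
Qed.

Lemma difference_product_inj (d : nat) (x : 'I_d.+1 -> nat) :
  difference_product x != 0 -> injective x.
Proof.
move=> /prodf_neq0 x_neq i j eq_x.
have [ij|ij|/val_inj //] := ltngtP i j.
  have := x_neq (exist _ (i, j) ij : color_pair d) isT.
  by rewrite subr_eq0 eqr_nat eq_x eqxx.
have := x_neq (exist _ (j, i) ij : color_pair d) isT.
by rewrite subr_eq0 eqr_nat eq_x eqxx.
Qed.

(* The edges of the [(d+1)]-regular multigraph on [W] whose [i]-th perfect matching
   joins [w] to [s i w]. *)
Definition matching_edge (W : finType) (d : nat) (s : 'I_d.+1 -> W -> W) :=
  {e : 'I_d.+1 * {set W} | [exists w, e.2 == [set w; s e.1 w]]}.

Lemma medge_subproof (W : finType) (d : nat) (s : 'I_d.+1 -> W -> W) i w :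
  [exists u, (i, [set w; s i w]).2 == [set u; s (i, [set w; s i w]).1 u]].
Proof. by apply/existsP; exists w. Qed.

Definition medge (W : finType) (d : nat) (s : 'I_d.+1 -> W -> W) i w :
    matching_edge s :=
  exist _ (i, [set w; s i w]) (medge_subproof s i w).


Lemma medge_involution (W : finType) (d : nat) (s : 'I_d.+1 -> W -> W) i w :
  involutive (s i) -> medge s i (s i w) = medge s i w.
Proof. by move=> sK; apply/val_inj; rewrite /= sK setUC. Qed.

Lemma card_medge_fiber (W : finType) (d : nat) (s : 'I_d.+1 -> W -> W) i
    (e : matching_edge s) :
  involutive (s i) -> (forall w, s i w != w) ->
  #|[pred w | medge s i w == e]| = (2 * ((val e).1 == i))%N.
Proof.
move=> sK s_neq; case: e => -[j A] /= eA.
have [ji|ji] := eqVneq j i; last first.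
  by apply: eq_card0 => w; rewrite !inE -val_eqE /= xpair_eqE eq_sym (negPf ji).
subst j; have /existsP[w /eqP /= defA] := eA.
transitivity #|[set w; s i w]|; last by rewrite cards2 eq_sym s_neq.
apply: eq_card => u; rewrite !inE -val_eqE /= xpair_eqE eqxx /= defA.
apply/eqP/orP => [eq_sets|[/eqP->|/eqP->] //]; last by rewrite sK setUC.
by have := set21 u (s i u); rewrite eq_sets => /set2P[->|->]; [left|right].
Qed.

(** Handshake count: each edge is met once from each of its two ends. *)
Lemma double_sum_medge (W : finType) (d : nat) (s : 'I_d.+1 -> W -> W)
    (P : pred (matching_edge s)) :
  (forall i, involutive (s i)) -> (forall i w, s i w != w) ->
  (\sum_w \sum_i P (medge s i w) = 2 * #|P|)%N.
Proof.
move=> sK s_neq; rewrite exchange_big /=.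
transitivity (\sum_i \sum_(e | P e) 2 * ((val e).1 == i))%N.
  apply: eq_bigr => i _; rewrite -big_mkcond /=.
  rewrite (partition_big (medge s i) P) //=; apply: eq_bigr => e Pe.
  rewrite -(card_medge_fiber e (sK i) (s_neq i)) -sum1_card; apply: eq_bigl => w.
  by rewrite inE; case: eqP => [->|]; rewrite ?Pe ?andbF.
rewrite exchange_big /= (eq_bigr (fun=> 2%N)) => [|e _].
  by rewrite mulnC -sum_nat_const; apply: eq_bigl.
rewrite -big_distrr /= (bigD1 (val e).1) //= eqxx big1 // => i.
by rewrite eq_sym => /negPf->.
Qed.

(** Ensures that the monomial with all exponents [d] has the degree of the graph polynomial of the
    line graph. *)
Lemma card_matching_edge (W : finType) (d : nat) (s : 'I_d.+1 -> W -> W) :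
  (forall i, involutive (s i)) -> (forall i w, s i w != w) ->
  #|{: W * color_pair d}| = (d * #|{: matching_edge s}|)%N.
Proof.
move=> sK s_neq; apply/eqP; rewrite -(eqn_pmul2l (isT : 0 < 2)%N) card_prod.
rewrite mulnCA card_color_pair (mulnCA 2) -(double_sum_medge predT sK s_neq).
by rewrite /= !sum_nat_const card_ord muln1 (mulnCA d) (mulnC d).
Qed.

(** * Choosability from coherent signs *)

Definition matching_coloring (W : finType) (d : nat) (s : 'I_d.+1 -> W -> W)
    (g : 'I_d.+1 -> W -> 'I_d.+1) :=
  (forall i w, g i (s i w) = g i w) /\ (forall w, injective (g^~ w)).

(** The right-hand side belongs to the colouring of the [i]-th matching by [i]. Permuting the
    colours at a vertex changes its factor at most in sign, so the condition says that all proper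
    colourings have the same sign. *)
Definition coherent_matchings (W : finType) (d : nat) (s : 'I_d.+1 -> W -> W) :=
  forall g, matching_coloring s g ->
    \prod_w difference_product (fun i => g i w)
    = \prod_(w : W) difference_product (fun i : 'I_d.+1 => i).

Definition ord_rat (d : nat) (i : 'I_d.+1) : rat := (i : nat)%:R.

Lemma ord_rat_inj (d : nat) : injective (@ord_rat d).
Proof. by move=> i j /eqP; rewrite eqr_nat => /eqP/val_inj. Qed.

(* All proper colourings contribute the same nonzero amount: every colour class is
   a perfect matching, so the weights agree, and the graph polynomial agrees by
   coherence. *)
Lemma coherent_sum_neq0 (W : finType) (d : nat) (s : 'I_d.+1 -> W -> W) :
  (forall i, involutive (s i)) -> (forall i w, s i w != w) ->
  coherent_matchings s ->
  \sum_(f : {ffun matching_edge s -> 'I_d.+1})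
      (\prod_e lagrange_weight (@ord_rat d) (f e)) *
      \prod_(j : W * color_pair d) (ord_rat (f (medge s (val j.2).1 j.1))
                                  - ord_rat (f (medge s (val j.2).2 j.1))) != 0.
Proof.
move=> sK s_neq coh; set x := @ord_rat d.
have x_inj : injective x := @ord_rat_inj d.
pose g (f : {ffun matching_edge s -> 'I_d.+1}) i w : 'I_d.+1 := f (medge s i w).
have graphE (f : {ffun matching_edge s -> 'I_d.+1}) :
    \prod_(j : W * color_pair d) (x (f (medge s (val j.2).1 j.1))
                                - x (f (medge s (val j.2).2 j.1)))
    = \prod_w difference_product (fun i => g f i w).
  by rewrite -(pair_bigA _ (fun w (k : color_pair d) =>
    x (f (medge s (val k).1 w)) - x (f (medge s (val k).2 w)))).
pose graph0 := \prod_(w : W) difference_product (fun i : 'I_d.+1 => i).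
have graph0_neq0 : graph0 != 0.
  by apply/prodf_neq0 => w _; apply/difference_product_neq0/val_inj.
(* Each colour occurs exactly once at each vertex, hence on [#|W|./2] edges. *)
pose weight0 := \prod_c lagrange_weight x c ^+ #|W|./2.
have weight0_neq0 : weight0 != 0.
  by apply/prodf_neq0 => c _; rewrite expf_neq0 // lagrange_weight_neq0.
pose proper (f : {ffun matching_edge s -> 'I_d.+1}) :=
  [forall w, injectiveb (fun i => g f i w)].
have properP (f : {ffun matching_edge s -> 'I_d.+1}) : reflect (forall w, injective (g f ^~ w)) (proper f).
  by apply: (iffP forallP) => inj_f w; apply/injectiveP/inj_f.
have termE (f : {ffun matching_edge s -> 'I_d.+1}) : (\prod_e lagrange_weight x (f e)) *
      \prod_(j : W * color_pair d) (x (f (medge s (val j.2).1 j.1))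
                                  - x (f (medge s (val j.2).2 j.1)))
    = (proper f)%:R * (weight0 * graph0).
  rewrite graphE; case: properP => [inj_f|not_inj]; last first.
    rewrite mul0r; apply/eqP; rewrite mulf_eq0; apply/orP; right.
    apply/negPn/negP => /prodf_neq0 neq0; apply: not_inj => w i j eq_g.
    apply: (difference_product_inj (neq0 w isT)); exact: congr1 eq_g.
  rewrite mul1r coh //; last by split=> // i w; rewrite /g medge_involution.
  congr (_ * _); rewrite (partition_big f xpredT) //=; apply: eq_bigr => c _.
  rewrite (eq_bigr (fun=> lagrange_weight x c)) => [|e /eqP-> //].
  rewrite prodr_const; congr (_ ^+ _).
  have := double_sum_medge (fun e => f e == c) sK s_neq.
  rewrite (eq_bigr (fun=> 1%N)) => [|w _]; last first.
    have [h gK hK] := injF_bij (inj_f w).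
    rewrite (bigD1 (h c)) //= [f _]hK eqxx big1 // => i.
    by apply: contraNeq; rewrite eqb0 negbK => /eqP <-; rewrite [h _]gK.
  by rewrite sum1_card => ->; rewrite mul2n doubleK; apply: eq_card.
rewrite (eq_bigr _ (fun f _ => termE f)) -mulr_suml mulf_neq0 ?mulf_neq0 //.
(* What remains is the number of proper colourings; giving each edge the index of its matching is
   one of them. *)
rewrite -natr_sum pnatr_eq0 -lt0n (bigD1 [ffun e => (val e).1]) //=.
suff -> : proper [ffun e => (val e).1] by [].
by apply/properP => w i j; rewrite /g !ffunE.
Qed.

(** The coefficient is nonzero for the lists [{0, ..., d}] and does not change for the lists [L], so
    the graph polynomial is nonzero at some choice from [L]. *)
Lemma coherent_matchings_choosable (W : finType) (d : nat) (s : 'I_d.+1 -> W -> W)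
    (L : 'I_d.+1 -> W -> seq nat) :
  (forall i, involutive (s i)) -> (forall i w, s i w != w) ->
  coherent_matchings s ->
  (forall i w, L i (s i w) = L i w) ->
  (forall i w, uniq (L i w) /\ size (L i w) = d.+1) ->
  exists h : 'I_d.+1 -> W -> nat,
    [/\ forall i w, h i (s i w) = h i w, forall i w, h i w \in L i w
      & forall w, injective (h^~ w)].
Proof.
move=> sK s_neq coh Ls uL.
have [w0 _|W0] := pickP (@predT W); last first.
  by exists (fun _ _ => 0%N); split=> [i w|i w|w]; have := W0 w.
(* Either end serves, since both carry the same list; [w0] is a mere default. *)
pose end1 (e : matching_edge s) := odflt w0 [pick w | (val e).2 == [set w; s (val e).1 w]].
pose L' (e : matching_edge s) := L (val e).1 (end1 e).
have L'E i w : L' (medge s i w) = L i w.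
  rewrite /L' /end1 /=; case: pickP => [u /eqP|/(_ w)]; last by rewrite eqxx.
  move=> eq_sets; have := set21 u (s i u); rewrite -eq_sets.
  by case/set2P=> -> //=.
pose x (e : matching_edge s) (i : 'I_d.+1) : rat := (nth 0%N (L' e) i)%:R.
have x_inj e : injective (x e).
  move=> i j /eqP; have [uLe sLe] := uL (val e).1 (end1 e).
  by rewrite eqr_nat nth_uniq ?sLe // => /eqP/val_inj.
pose p (j : W * color_pair d) := medge s (val j.2).1 j.1.
pose q (j : W * color_pair d) := medge s (val j.2).2 j.1.
have := coherent_sum_neq0 sK s_neq coh; rewrite /=.
have cardE := card_matching_edge sK s_neq.
(* The sum over orientations is the bridge from the standard lists to [L]. *)
rewrite (graph_polynomial_coefficient p q (x := fun=> @ord_rat d) cardE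
  (fun e t => sum_lagrange_weight (@ord_rat_inj d))).
rewrite -(graph_polynomial_coefficient p q (x := x) cardE
  (fun e t => sum_lagrange_weight (@x_inj e))).
have [f f_neq0 _|f0] := pickP (fun f : {ffun matching_edge s -> 'I_d.+1} =>
  \prod_j (x (p j) (f (p j)) - x (q j) (f (q j))) != 0); last first.
  by rewrite big1 ?eqxx // => f _; have /negPn/eqP-> := negbT (f0 f); rewrite mulr0.
exists (fun i w => nth 0%N (L i w) (f (medge s i w))); split=> [i w|i w|w].
- by rewrite Ls medge_involution.
- by rewrite mem_nth // (uL i w).2.
- apply: difference_product_inj; apply/prodf_neq0 => k _.
  by have /prodf_neq0/(_ (w, k) isT) := f_neq0; rewrite /x !L'E.
Qed.

Local Close Scope ring_scope.

(** * Edge colourings padded to perfect matchings *)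

Definition edge_coloring (V : finType) (e : rel V) (col : V -> V -> nat) :=
  (forall x y, col x y = col y x) /\
  (forall x y z, e x y -> e x z -> col x y = col x z -> y = z).

Definition mate (V : finType) (e : rel V) (col : V -> V -> nat) (c : nat) (v : V) :=
  [pick u | e v u && (col v u == c)].

Lemma mate_edge (V : finType) (e : rel V) (col : V -> V -> nat) (x y : V) :
  edge_coloring e col -> e x y -> mate e col (col x y) x = Some y.
Proof.
case=> _ col_inj exy; rewrite /mate; case: pickP => [u /andP[exu /eqP eq_col]|/(_ y)].
  by congr Some; apply: col_inj eq_col.
by rewrite exy eqxx.
Qed.

Lemma mateP (V : finType) (e : rel V) (col : V -> V -> nat) (c : nat) (x y : V) :
  mate e col c x = Some y -> e x y /\ col x y = c.
Proof. by rewrite /mate; case: pickP => // u /andP[exu /eqP ?] [<-]. Qed.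

(* The matchings with colours [a], ..., [a + d], made perfect by taking two copies of
   the graph and joining the copies of an unmatched vertex. *)
Definition pad (V : finType) (e : rel V) (col : V -> V -> nat) (a d : nat)
    (i : 'I_d.+1) (w : V * bool) : V * bool :=
  if mate e col (a + i) w.1 is Some u then (u, w.2) else (w.1, ~~ w.2).

Lemma padK (V : finType) (e : rel V) (col : V -> V -> nat) (a d : nat)
    (i : 'I_d.+1) :
  symmetric e -> edge_coloring e col -> involutive (pad e col a i).
Proof.
move=> e_sym colP [v b]; rewrite /pad /=.
case mate_v: (mate e col _ v) => [u|] /=; last by rewrite mate_v negbK.
have [evu <-] := mateP mate_v.
by rewrite colP.1 mate_edge // e_sym.
Qed.

Lemma pad_neq (V : finType) (e : rel V) (col : V -> V -> nat) (a d : nat)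
    (i : 'I_d.+1) (w : V * bool) :
  irreflexive e -> pad e col a i w != w.
Proof.
move=> e_irr; case: w => v b; rewrite /pad /=.
case mate_v: (mate e col _ v) => [u|] /=; last first.
  by rewrite xpair_eqE negb_and; case: b; rewrite orbT.
have [evu _] := mateP mate_v.
by rewrite xpair_eqE negb_and; apply/orP; left; apply: contraTneq evu => ->; rewrite e_irr.
Qed.

Lemma pad_edge (V : finType) (e : rel V) (col : V -> V -> nat) (a d : nat)
    (i : 'I_d.+1) (x y : V) (b : bool) :
  edge_coloring e col -> e x y -> col x y = a + i -> pad e col a i (x, b) = (y, b).
Proof. by move=> colP exy col_xy; rewrite /pad -col_xy mate_edge. Qed.

Definition block_choosable (V : finType) (e : rel V) (col : V -> V -> nat) (a d : nat) :=
  forall L : V -> V -> seq nat,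
    (forall x y, L x y = L y x) ->
    (forall x y, e x y -> uniq (L x y) /\ size (L x y) = d.+1) ->
    exists h : V -> V -> nat,
      [/\ forall x y, e x y -> a <= col x y <= a + d -> h x y = h y x,
          forall x y, e x y -> a <= col x y <= a + d -> h x y \in L x y
        & forall x y z, e x y -> e x z -> y != z ->
            a <= col x y <= a + d -> a <= col x z <= a + d -> h x y != h x z].

Lemma coherent_block_choosable (V : finType) (e : rel V) (col : V -> V -> nat)
    (a d : nat) :
  symmetric e -> irreflexive e -> edge_coloring e col ->
  coherent_matchings (@pad V e col a d) -> block_choosable e col a d.
Proof.
move=> e_sym e_irr colP coh L L_sym uL.
(* An edge joining the two copies of an unmatched vertex gets an arbitrary list of the right
   size. *)
pose L' (i : 'I_d.+1) (w : V * bool) :=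
  if mate e col (a + i) w.1 is Some u then L w.1 u else iota 0 d.+1.
have sK i : involutive (@pad V e col a d i) by apply: padK.
have s_neq i w : @pad V e col a d i w != w by apply: pad_neq.
have L'_inv i w : L' i (pad e col a i w) = L' i w.
  case: w => v b; rewrite /L' /pad /=.
  case mate_v: (mate e col _ v) => [u|] /=; last by rewrite mate_v.
  have [evu <-] := mateP mate_v.
  by rewrite (colP.1 v) mate_edge 1?L_sym // e_sym.
have uL' i w : uniq (L' i w) /\ size (L' i w) = d.+1.
  case: w => v b; rewrite /L' /=.
  case mate_v: (mate e col _ v) => [u|] /=; last first.
    by split; [exact: (iota_uniq 0 d.+1) | rewrite size_iota].
  by have [evu _] := mateP mate_v; apply: uL.
have [h [h_inv h_in h_inj]] := coherent_matchings_choosable sK s_neq coh L'_inv uL'.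
have inordE c : a <= c <= a + d -> a + (inord (c - a) : 'I_d.+1) = c.
  by case/andP=> ac cd; rewrite inordK ?subnKC // ltnS leq_subLR.
(* Only the copy [false] is read off. *)
exists (fun x y => h (inord (col x y - a)) (x, false)); split.
- move=> x y exy /inordE col_xy; rewrite (colP.1 y x).
  by rewrite -h_inv (pad_edge (y := y)).
- move=> x y exy /inordE col_xy.
  by have := h_in (inord (col x y - a)) (x, false); rewrite /L' /= col_xy mate_edge.
- move=> x y z exy exz yz /inordE col_xy /inordE col_xz.
  rewrite (inj_eq (h_inj _)); apply: contra yz => /eqP eq_ord.
  by apply/eqP/(colP.2 x) => //; rewrite -col_xy eq_ord col_xz.
Qed.

(** * Criteria for coherence *)

(** The orbits of [t] are pairs, each contributing [c]. Viewed as a single matching, [t] has these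
    pairs as its edges. *)
Lemma prod_involution (R : comNzRingType) (W : finType) (t : W -> W) (F : W -> R)
    (c : R) :
  involutive t -> (forall w, t w != w) -> (forall w, F (t w) = F w) ->
  (forall w, F w ^+ 2 = c)%R -> (\prod_w F w = c ^+ #|W|./2)%R.
Proof.
move=> tK t_neq Ft F2; pose t' (i : 'I_1) := t.
rewrite (partition_big (medge t' ord0) xpredT) //= (eq_bigr (fun=> c)) => [|e _].
  have := double_sum_medge (s := t') predT (fun=> tK) (fun=> t_neq).
  rewrite prodr_const (eq_bigr (fun=> 1%N)) => [|w _]; last by rewrite big_ord1.
  by rewrite sum1_card => ->; rewrite mul2n doubleK; congr (_ ^+ _)%R; apply: eq_card.
have e0 : (val e).1 = ord0 by rewrite ord1.
have := card_medge_fiber e tK t_neq; rewrite e0 => card_e.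
have /card_gt0P[w0 /eqP w0e] : 0 < #|[pred w | medge t' ord0 w == e]|.
  by rewrite card_e.
rewrite (eq_bigr (fun=> F w0)) => [|w]; last first.
  rewrite -w0e -val_eqE xpair_eqE => /andP[_ /eqP /= eq_sets].
  by have := set21 w (t w); rewrite eq_sets => /set2P[->|->].
by rewrite prodr_const card_e F2.
Qed.

(* The square is, up to a sign depending only on [d], the product over all ordered
   pairs of distinct indices, which a permutation reindexes. *)
Lemma difference_product_sqr (d : nat) (x : 'I_d.+1 -> 'I_d.+1) :
  injective x ->
  (difference_product x ^+ 2 = difference_product (fun i : 'I_d.+1 => i) ^+ 2)%R.
Proof.
move=> x_inj; pose lt_pair := [pred ij : 'I_d.+1 * 'I_d.+1 | ij.1 < ij.2].
have sqrE (y : 'I_d.+1 -> 'I_d.+1) : (difference_product y ^+ 2 =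
    (-1) ^+ #|{: color_pair d}| *
    \prod_(ij : 'I_d.+1 * 'I_d.+1 | ij.1 != ij.2) (ord_rat (y ij.1) - ord_rat (y ij.2)))%R.
  rewrite (bigID (fun ij : 'I_d.+1 * 'I_d.+1 => ij.1 < ij.2)) /=.
  rewrite (eq_bigl (mem lt_pair)); last first.
    by move=> ij; rewrite !inE -val_eqE /=; lia.
  rewrite (big_sub lt_pair) /=.
  rewrite mulrCA expr2; congr (_ * _)%R.
  rewrite (reindex_inj (h := fun ij : 'I_d.+1 * 'I_d.+1 => (ij.2, ij.1))) /=; last first.
    by move=> [i j] [k l] [-> ->].
  rewrite (eq_bigl (mem lt_pair)); last first.
    by move=> ij; rewrite !inE -val_eqE /=; lia.
  rewrite (big_sub lt_pair) /=.
  rewrite -prodr_const -big_split /=; apply: eq_bigr => ij _.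
  by rewrite mulN1r opprB.
rewrite sqrE (sqrE id); congr (_ * _)%R.
rewrite [RHS](reindex_inj (h := fun ij => (x ij.1, x ij.2))) /=; last first.
  by move=> [i j] [k l] [/x_inj-> /x_inj->].
by apply: eq_bigl => ij; rewrite (inj_eq x_inj).
Qed.

(** The vertices [w] and [t w] see the same colours, so together they contribute the square of a
    Vandermonde product, which no permutation changes. *)
Lemma involution_coherent (W : finType) (d : nat) (s : 'I_d.+1 -> W -> W)
    (t : W -> W) :
  involutive t -> (forall w, t w != w) ->
  (forall g, matching_coloring s g -> forall i w, g i (t w) = g i w) ->
  coherent_matchings s.
Proof.
move=> tK t_neq t_inv g gP.
pose c := (difference_product (fun i : 'I_d.+1 => i) ^+ 2)%R.
rewrite (prod_involution (c := c) tK t_neq) => [||w]; last first.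
- by apply: difference_product_sqr; apply: gP.2.
- by move=> w; apply: eq_bigr => -[[i j] /= ij] _; rewrite !(t_inv g).
by rewrite (prod_involution (c := c) tK t_neq).
Qed.

(** The matching [s ord0] is the involution: its own colour is shared by both ends, and with at most
    two colours any other one is forced. *)
Lemma small_coherent (W : finType) (d : nat) (s : 'I_d.+1 -> W -> W) :
  d <= 1 -> (forall i, involutive (s i)) -> (forall i w, s i w != w) ->
  coherent_matchings s.
Proof.
move=> d_le1 sK s_neq.
apply: (involution_coherent (sK ord0) (s_neq ord0)) => g [g_inv g_inj] k w.
have [->|k0] := eqVneq k ord0; first exact: g_inv.
have neq0 u : (g k u : nat) <> g ord0 u by move/val_inj/g_inj; apply/eqP.
have := neq0 w; have := neq0 (s ord0 w); rewrite g_inv => neq1 neq2.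
have lt_d u l : g l u < d.+1 by apply: ltn_ord.
by apply/val_inj => /=; move: (lt_d w k) (lt_d (s ord0 w) k) (lt_d w ord0); lia.
Qed.

(** * The round-robin 1-factorization *)

(** Vertices are the residues modulo [r.*2.+1] and a point at infinity, [ord_max]. An edge is
    coloured by the sum of its ends, infinity being replaced by the other end. *)
Definition round_robin (r : nat) (x y : 'I_r.*2.+2) : nat :=
  (if y == ord_max then x + x else if x == ord_max then y + y else x + y) %% r.*2.+1.

Definition residue_vertex (r k : nat) : 'I_r.*2.+2 := inord (k %% r.*2.+1).

Lemma val_residue_vertex (r k : nat) : residue_vertex r k = k %% r.*2.+1 :> nat.
Proof. by rewrite inordK // ltnS ltnW // ltn_pmod. Qed.

Lemma residue_vertex_neq_max (r k : nat) : residue_vertex r k != ord_max.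
Proof. by rewrite -val_eqE /= val_residue_vertex ltn_eqF // ltn_pmod. Qed.

Lemma residue_vertex_mod (r j k : nat) :
  (residue_vertex r j == residue_vertex r k) = (j == k %[mod r.*2.+1]).
Proof. by rewrite -val_eqE /= !val_residue_vertex. Qed.

Lemma residue_vertex_val (r : nat) (x : 'I_r.*2.+2) :
  x != ord_max -> residue_vertex r x = x.
Proof.
rewrite -val_eqE /= => x_neq; apply/val_inj; rewrite /= val_residue_vertex modn_small //.
by have := ltn_ord x; rewrite ltnS leq_eqVlt (negPf x_neq).
Qed.

Lemma round_robin_residue (r j k : nat) :
  round_robin (residue_vertex r j) (residue_vertex r k) = (j + k) %% r.*2.+1.
Proof.
by rewrite /round_robin !(negPf (residue_vertex_neq_max _ _)) !val_residue_vertex modnDm.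
Qed.

Lemma round_robin_max (r j : nat) :
  round_robin (residue_vertex r j) ord_max = (j + j) %% r.*2.+1.
Proof. by rewrite /round_robin eqxx val_residue_vertex modnDm. Qed.

Lemma round_robinC (r : nat) (x y : 'I_r.*2.+2) : round_robin x y = round_robin y x.
Proof.
rewrite /round_robin; have [->|y_fin] := eqVneq y ord_max;
  by have [eq_x|x_fin] := eqVneq x ord_max; rewrite ?eq_x //= addnC.
Qed.

Lemma ltn_round_robin (r : nat) (x y : 'I_r.*2.+2) : round_robin x y < r.*2.+1.
Proof. exact: ltn_pmod. Qed.

(** The inverse of 2 modulo [r.*2.+1] is [r.+1]. *)
Lemma double_inj_mod (r j k : nat) :
  j + j = k + k %[mod r.*2.+1] -> j = k %[mod r.*2.+1].
Proof.
move=> eq_jk; have half i : i = (i + i) * r.+1 %[mod r.*2.+1].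
  have -> : (i + i) * r.+1 = i * r.*2.+1 + i by rewrite -mul2n; nia.
  by rewrite modnMDl.
by rewrite half [RHS]half -modnMml eq_jk modnMml.
Qed.

Lemma round_robin_edge_coloring (r : nat) :
  edge_coloring (@complete_rel r.*2.+2) (@round_robin r).
Proof.
split=> [|x y z]; first exact: round_robinC.
rewrite /complete_rel => xy xz.
have [xm|x_fin] := eqVneq x ord_max.
  subst x; rewrite !(round_robinC ord_max).
  rewrite -(residue_vertex_val (x := y)) 1?eq_sym // -(residue_vertex_val (x := z)) 1?eq_sym //.
  by rewrite !round_robin_max => /double_inj_mod/eqP; rewrite -residue_vertex_mod => /eqP.
have fin_max u : x != u -> u != ord_max -> round_robin x u <> round_robin x ord_max.
  move=> xu u_fin; rewrite -(residue_vertex_val x_fin) -(residue_vertex_val u_fin).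
  rewrite round_robin_max round_robin_residue => /eqP; rewrite eqn_modDl.
  by rewrite -residue_vertex_mod !residue_vertex_val // => /eqP ux; rewrite ux eqxx in xu.
have [->|y_fin] := eqVneq y ord_max; have [->|z_fin] := eqVneq z ord_max => //.
- by move/esym => eq_c; case: (fin_max z).
- by move=> eq_c; case: (fin_max y).
rewrite -(residue_vertex_val x_fin) -(residue_vertex_val y_fin) -(residue_vertex_val z_fin).
rewrite !round_robin_residue => /eqP; rewrite eqn_modDl.
by rewrite -residue_vertex_mod => /eqP.
Qed.

(* Three consecutive matchings form a ladder with rungs [v0 + k], [v0 - k], closed at
   both ends; its 3-edge-colouring is unique because the colours at one rung force
   those at the next. *)
Lemma round_robin_rigid (r a : nat) (g : 'I_3 -> 'I_r.*2.+2 * bool -> 'I_3) :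
  a + 2 < r.*2.+1 ->
  matching_coloring (@pad _ (@complete_rel r.*2.+2) (@round_robin r) a 2) g ->
  forall i u v b, g i (u, b) = g i (v, b).
Proof.
move=> a_lt [g_inv g_inj] i u v b; pose m := r.*2.+1.
have edgeE (k : 'I_3) x y :
    x != y -> round_robin x y = a + k -> g k (x, b) = g k (y, b).
  move=> xy col_xy; rewrite -(g_inv k (x, b)).
  by rewrite (pad_edge _ (round_robin_edge_coloring r) xy col_xy).
(* With three colours at each vertex, agreement on two matchings forces it on the third. *)
have third (x y : 'I_r.*2.+2 * bool) (k : 'I_3) :
    (forall l, l != k -> g l x = g l y) -> g k x = g k y.
  move=> eq_g.
  have [h gK hK] := injF_bij (@g_inj x).
  have [h0|] := eqVneq (h (g k y)) k; first by rewrite -[in LHS]h0 [LHS]hK.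
  move=> neq; have := eq_g _ neq; rewrite [LHS]hK => /g_inj e.
  by rewrite -e eqxx in neq.
(* Half of [a + 1] modulo [m], so that the rungs have the middle colour [a + 1]. *)
pose v0 := (a + 1) * r.+1.
pose P k := (residue_vertex r (v0 + k), b); pose Q k := (residue_vertex r (v0 - k), b).
have v0_double : v0 + v0 = (a + 1) * m + (a + 1) by rewrite /v0 /m -mul2n; nia.
(* Keeps the truncated subtraction [v0 - k] exact for [k <= r]. *)
have v0_large : r < v0 by rewrite /v0; nia.
have colE (j : 'I_3) c : c = (a + 1) * m + (a + j) -> c %% m = a + j.
  by move=> ->; rewrite modnMDl modn_small //; have := ltn_ord j; rewrite /m; lia.
pose i0 : 'I_3 := @Ordinal 3 0 isT.
pose i1 : 'I_3 := @Ordinal 3 1 isT.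
pose i2 : 'I_3 := @Ordinal 3 2 isT.
have PQ_edge (l : 'I_3) j k :
    k <= r -> 0 < j + k < m -> j + 1 = k + l -> g l (P j) = g l (Q k).
  move=> kr /andP[jk_gt0 jk_lt] jkl; apply: edgeE.
    rewrite residue_vertex_mod eqn_mod_dvd; last by lia.
    have -> : v0 + j - (v0 - k) = j + k by lia.
    by apply/negP => /dvdn_leq; lia.
  by rewrite round_robin_residue; apply: colE; lia.
(* The diagonals from [P k.+1] to [Q k] and from [P k] to [Q k.+1] lie in the outer matchings and
   carry their colours to the next rung. *)
have ladder k : k <= r ->
    (forall l, g l (P k) = g l (P 0)) /\ (forall l, g l (Q k) = g l (P 0)).
  elim: k => [|k IHk] k_le; first by rewrite /Q /P subn0 addn0.
  have [IHP IHQ] := IHk (ltnW k_le).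
  have P2 : g i2 (P k.+1) = g i2 (P 0) by rewrite (PQ_edge i2 k.+1 k) //=; lia.
  have Q0 : g i0 (Q k.+1) = g i0 (P 0) by rewrite -(PQ_edge i0 k k.+1) //=; lia.
  have PQ1 : g i1 (P k.+1) = g i1 (Q k.+1) by apply: PQ_edge => //=; lia.
  have ord3 (l : 'I_3) : [\/ l = i0, l = i1 | l = i2].
    case: l => [[|[|[|]]]] // lt_l; [constructor 1|constructor 2|constructor 3]; exact: val_inj.
  (* The next rung avoids [g i2 (P 0)] at one end and [g i0 (P 0)] at the other, which leaves one
     colour. *)
  have PQ1' : g i1 (P k.+1) = g i1 (P 0).
    have neq l l' x : l != l' -> (g l x : nat) <> g l' x.
      by move=> ll' /val_inj/g_inj; apply/eqP.
    apply/val_inj.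
    have := (neq i1 i0 (P 0) isT, neq i1 i2 (P 0) isT, neq i0 i2 (P 0) isT).
    have := (neq i1 i2 (P k.+1) isT, neq i1 i0 (Q k.+1) isT).
    rewrite -PQ1 P2 Q0 => -[n1 n2] [[n3 n4] n5] /=.
    have lt3 l x : g l x < 3 by apply: ltn_ord.
    by move: (lt3 i1 (P k.+1)) (lt3 i1 (P 0)) (lt3 i2 (P 0)) (lt3 i0 (P 0)); lia.
  split=> l; have [->|->|->] // := ord3 l.
  - by apply: third => l'; have [->|->|->] := ord3 l'.
  - by rewrite -PQ1.
  - apply: third => l'; have [->|->|->] // := ord3 l'.
    by rewrite -PQ1.
have fin l w : g l (residue_vertex r w, b) = g l (P 0).
  (* As [r.*2] is -1 modulo [m], [t] represents [w - v0]; the vertex is [P t] or [Q (m - t)]. *)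
  pose t := (w + r.*2 * v0) %% m.
  have t_lt : t < m by apply: ltn_pmod.
  have eq_t : v0 + t = w %[mod m].
    rewrite modnDmr (_ : v0 + _ = v0 * m + w); last by rewrite /m; nia.
    by rewrite modnMDl.
  have [t_le|t_gt] := leqP t r.
    have /eqP := eq_t; rewrite -residue_vertex_mod => /eqP <-.
    exact: (ladder t t_le).1.
  have kr : m - t <= r by rewrite /m in t_lt *; lia.
  have : v0 - (m - t) == w %[mod m].
    rewrite -eq_t (_ : v0 + t = v0 - (m - t) + m); last by lia.
    by rewrite modnDr.
  by rewrite -residue_vertex_mod => /eqP <-; exact: (ladder _ kr).2.
have all_v l x : g l (x, b) = g l (P 0).
  have [->|x_fin] := eqVneq x ord_max; last by rewrite -(residue_vertex_val x_fin) fin.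
  (* Matching [l] joins infinity to half of [a + l]. *)
  rewrite -(fin l ((a + l) * r.+1)); apply/esym/edgeE.
    exact: residue_vertex_neq_max.
  rewrite round_robin_max (_ : _ + _ = (a + l) * m + (a + l)); last by rewrite /m; nia.
  by rewrite modnMDl modn_small //; have := ltn_ord l; rewrite /m; lia.
by rewrite !all_v.
Qed.

Lemma round_robin_coherent (r a d : nat) :
  d <= 2 -> a + d < r.*2.+1 ->
  coherent_matchings (@pad _ (@complete_rel r.*2.+2) (@round_robin r) a d).
Proof.
have e_sym : symmetric (@complete_rel r.*2.+2) by move=> x y; rewrite /complete_rel eq_sym.
have e_irr : irreflexive (@complete_rel r.*2.+2) by move=> x; rewrite /complete_rel eqxx.
rewrite leq_eqVlt => /predU1P[->|d_le1] ad_lt; last first.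
  apply: small_coherent => // [i|i w]; last exact: pad_neq.
  exact: padK e_sym (round_robin_edge_coloring r).
(* By rigidity, any fixed-point-free involution preserving each copy will do; [rev_ord] has no fixed
   point because the number of vertices is even. *)
pose t (w : 'I_r.*2.+2 * bool) := (rev_ord w.1, w.2).
apply: (@involution_coherent _ _ _ t) => [[x b]|[x b]|g gP i [x b]].
- by rewrite /t /= rev_ordK.
- rewrite xpair_eqE eqxx andbT -val_eqE /=; have := ltn_ord x; lia.
- exact: round_robin_rigid ad_lt gP i _ _ _.
Qed.

(** * Assembling the blocks *)

Lemma set2_eq (T : finType) (x y u v : T) :
  u != v -> [set x; y] = [set u; v] -> (x = u /\ y = v) \/ (x = v /\ y = u).
Proof.
move=> uv eq_sets.
have : u \in [set x; y] by rewrite eq_sets set21.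
have : v \in [set x; y] by rewrite eq_sets set22.
move=> /set2P[vE|vE] /set2P[uE|uE]; subst; try by rewrite eqxx in uv.
- by right.
- by left.
Qed.

Lemma is_edge_set2 (V : finType) (e : rel V) (x y : V) : e x y -> is_edge e [set x; y].
Proof. by move=> exy; apply/existsP; exists x; apply/existsP; exists y; rewrite exy eqxx. Qed.

(** The colours of [col] are cut into consecutive intervals whose lengths are the parts, and the
    [i]-th interval is recoloured from the [i]-th class. Different intervals cannot clash, as the
    classes are disjoint. *)
Lemma blocks_lambda_choosable (V : finType) (e : rel V) (col : V -> V -> nat)
    (lam : seq nat) :
  symmetric e -> irreflexive e -> edge_coloring e col ->
  all (fun k => 0 < k) lam -> (forall x y, e x y -> col x y < sumn lam) ->
  (forall i, i < size lam -> block_choosable e col (sumn (take i lam)) (nth 0 lam i).-1) ->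
  edge_lambda_choosable e lam.
Proof.
move=> e_sym e_irr colP lam_gt0 col_lt blocks L [L_uniq [part L_part]].
pose LV x y := if insub [set x; y] is Some t then L (t : edge_type e) else [::].
have LVC x y : LV x y = LV y x by rewrite /LV setUC.
have LVE (t : edge_type e) x y : val t = [set x; y] -> LV x y = L t.
  by move=> tE; rewrite /LV -tE valK.
have edgeE x y : e x y -> exists t : edge_type e, val t = [set x; y].
  by move/is_edge_set2 => exy; exists (Sub _ exy).
have blockP (i : 'I_(size lam)) : exists h : V -> V -> nat,
    let inblock x y := e x y /\ reshape_index lam (col x y) = i in
    [/\ forall x y, inblock x y -> h x y = h y x,
        forall x y, inblock x y -> h x y \in LV x y /\ part (h x y) = i
      & forall x y z, inblock x y -> inblock x z -> y != z -> h x y != h x z].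
  have lam_i : (nth 0 lam i).-1.+1 = nth 0 lam i.
    by rewrite prednK //; apply: (allP lam_gt0); apply: mem_nth.
  have [x y|x y exy|h [h_sym h_in h_neq]] :=
    blocks i (ltn_ord i) (fun x y => [seq c <- LV x y | part c == i]).
  - by rewrite LVC.
  - have [t tE] := edgeE x y exy; rewrite (LVE t) // size_filter L_part // lam_i.
    by rewrite filter_uniq // (L_uniq t).1.
  have range x y : e x y -> reshape_index lam (col x y) = i ->
      sumn (take i lam) <= col x y <= sumn (take i lam) + (nth 0 lam i).-1.
    move=> exy idx; have := reshape_offsetP (col_lt x y exy).
    rewrite -{3 4}(reshape_indexK lam (col x y)) /flatten_index idx leq_addr leq_add2l.
    by rewrite -{1}lam_i ltnS.
  exists h; split=> [x y [exy /(range x y exy)]|x y [exy /(range x y exy) bxy]|x y z].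
  - exact: h_sym.
  - by have := h_in x y exy bxy; rewrite mem_filter => /andP[/eqP].
  - move=> [exy /(range x y exy) bxy] [exz /(range x z exz) bxz] yz.
    exact: h_neq.
have {blockP} [h hP] := fin_all_exists blockP.
pose idx x y := reshape_index lam (col x y).
(* The default 0 is never reached on an edge, where [col] is below [sumn lam]. *)
pose hh x y := if insub (idx x y) is Some i then h i x y else 0.
have hhE x y : e x y -> exists2 i : 'I_(size lam), idx x y = i & hh x y = h i x y.
  move=> exy; have idx_lt := reshape_indexP (col_lt x y exy).
  by exists (Ordinal idx_lt) => //; rewrite /hh insubT.
have colour_exists (t : edge_type e) : exists c, forall x y, e x y -> val t = [set x; y] -> c = hh x y.
  have /existsP[x /existsP[y /andP[exy /eqP tE]]] := valP t.
  exists (hh x y) => u v euv; rewrite tE => /set2_eq[|[-> ->] //|[xv yu]].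
    by apply: contraTneq euv => ->; rewrite e_irr.
  rewrite {}xv {}yu in exy *.
  rewrite /hh /idx (colP.1 v u); case: insubP => // i _ /= idx_i.
  have [h_sym _ _] := hP i.
  by apply/esym/h_sym; split=> //; rewrite idx_i.
have [f fE] := fin_all_exists colour_exists.
exists f; split=> [t|t1 t2 /andP[t12 /set0Pn[x /setIP[xt1 xt2]]]].
  have /existsP[x /existsP[y /andP[exy /eqP tE]]] := valP t.
  rewrite (fE t x y exy tE); have [i idx_i ->] := hhE x y exy.
  have [_ h_in _] := hP i.
  by rewrite -(LVE t x y tE); apply: (h_in x y _).1.
have other_end (t : edge_type e) : x \in val t -> exists2 y, e x y & val t = [set x; y].
  have /existsP[u /existsP[v /andP[euv /eqP ->]]] := valP t.
  by case/set2P=> ->; [exists v | exists u; rewrite 1?setUC // e_sym].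
have [y exy t1E] := other_end t1 xt1.
have [z exz t2E] := other_end t2 xt2.
have yz : y != z.
  by apply: contra t12 => /eqP yz; rewrite -val_eqE t1E t2E yz.
rewrite (fE t1 x y exy t1E) (fE t2 x z exz t2E).
have [i idx_i ->] := hhE x y exy; have [j idx_j ->] := hhE x z exz.
have [_ h_in h_neq] := hP i; have [_ h_in' _] := hP j.
have [ij|ij] := eqVneq i j.
  by rewrite -ij; apply: h_neq => //; split=> //; rewrite -/(idx x z) idx_j ij.
have [_ part_i] := h_in x y (conj exy idx_i).
have [_ part_j] := h_in' x z (conj exz idx_j).
by apply: contra ij => /eqP eq_h; rewrite -val_eqE /= -part_i eq_h part_j.
Qed.

Lemma edge_colourable_coloring (V : finType) (e : rel V) (k : nat) :
  irreflexive e -> edge_colourable e k ->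
  exists2 col, edge_coloring e col & forall x y, e x y -> col x y < k.
Proof.
move=> e_irr [f f_proper].
exists (fun x y => if insub [set x; y] is Some t then f t : nat else 0).
  split=> [x y|x y z exy exz]; first by rewrite setUC.
  rewrite !insubT ?is_edge_set2 // => hz hy eq_f; apply/eqP.
  apply: contraT => yz.
  suff /f_proper : line_adj (Sub _ hy : edge_type e) (Sub _ hz).
    by move/eqP; case; apply/val_inj.
  apply/andP; split; last by apply/set0Pn; exists x; rewrite inE !set21.
  rewrite -val_eqE /=; apply: contra yz => /eqP/set2_eq[|[_ ->] //|[xz yx]].
    by apply: contraTneq exz => ->; rewrite e_irr.
  by rewrite xz e_irr in exz.
by move=> x y exy; rewrite insubT ?is_edge_set2 // => h; apply: ltn_ord.
Qed.

Theorem theorem10 :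
  (forall (V : finType) (e : rel V), symmetric e -> irreflexive e ->
     forall (k : nat) (lam : seq nat), is_partition k lam ->
       all (fun x => x <= 2) lam ->
       edge_colourable e k -> edge_lambda_choosable e lam)
  /\
  (forall (n : nat), 0 < n -> ~~ odd n ->
     forall lam : seq nat, is_partition (n - 1) lam ->
       all (fun x => x <= 3) lam ->
       @edge_lambda_choosable 'I_n (@complete_rel n) lam).
Proof.
split=> [V e e_sym e_irr k lam [lam_gt0 lam_k] lam_le2|n n_gt0 n_even lam [lam_gt0 lam_n] lam_le3].
  move=> /(edge_colourable_coloring e_irr)[col colP col_lt].
  apply: (blocks_lambda_choosable e_sym e_irr colP lam_gt0); rewrite ?lam_k // => i i_lt.
  apply: coherent_block_choosable => //; apply: small_coherent.
  - by have := all_nthP 0 lam_le2 i i_lt; case: (nth 0 lam i) => [|[|[]]].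
  - by move=> j; apply: padK.
  - by move=> j w; apply: pad_neq.
have [r nE] : exists r, n = r.*2.+2.
  by exists n./2.-1; have := odd_double_half n; rewrite (negPf n_even); lia.
subst n; rewrite subn1 /= in lam_n.
have e_sym : symmetric (@complete_rel r.*2.+2) by move=> x y; rewrite /complete_rel eq_sym.
have e_irr : irreflexive (@complete_rel r.*2.+2) by move=> x; rewrite /complete_rel eqxx.
have colP := round_robin_edge_coloring r.
apply: (blocks_lambda_choosable e_sym e_irr colP lam_gt0) => [x y _|i i_lt].
  by rewrite lam_n ltn_round_robin.
apply: coherent_block_choosable => //; apply: round_robin_coherent.
  by have := all_nthP 0 lam_le3 i i_lt; case: (nth 0 lam i) => [|[|[|[]]]].
(* Parts are positive, so the predecessor keeps the last colour of the block below [sumn lam]. *)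
have nth_gt0 := all_nthP 0 lam_gt0 i i_lt.
rewrite -lam_n -[X in _ < sumn X](cat_take_drop i lam) sumn_cat (drop_nth 0) //=.
by rewrite ltn_add2l; lia.
Qed.
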